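(* Let $X$ be a finite set with $|X|\ge 2$, and let $K\subseteq \mathcal{D}\text{-}\mathrm{Geo}(\mathrm{FIM}_X)$ be a language containing at least one representative for each $\mathcal{D}$-class of $\mathrm{FIM}_X$ (i.e. for every $\mathcal{D}$-class $C$ there is $w\in K$ with $w\pi\in C$). Then $K$ is not context-free. In particular, for any total order on $\tilde X$, the languages $\mathcal{D}\text{-}\mathrm{Geo}(\mathrm{FIM}_X)$ and $\mathcal{D}\text{-}\mathrm{SL}(\mathrm{FIM}_X)$ are not context-free.
   Context: $\mathrm{FIM}_X$ is the free inverse monoid on $X$; $\tilde X=X\cup X^{-1}$ with $X^{-1}=\{x^{-1}:x\in X\}$ a disjoint copy of $X$; $\pi:\tilde X^*\to \mathrm{FIM}_X$ is the canonical surjective homomorphism; $\ell(w)$ is the length of the word $w$; $\mathcal{D}$ is Green's relation on $\mathrm{FIM}_X$. Then $$\mathcal{D}\text{-}\mathrm{Geo}(\mathrm{FIM}_X)=\bigl\{w\in\tilde X^*: \ell(w)=\min\{\ell(u): u\in\tilde X^*,\ (u\pi)\,\mathcal{D}\,(w\pi)\}\bigr\}.$$ A total order on $\tilde X$ induces the ShortLex order on $\tilde X^*$ (shorter words first, words of equal length compared lexicographically), and $\mathcal{D}\text{-}\mathrm{SL}(\mathrm{FIM}_X)$ is the set of $w\in\tilde X^*$ that are ShortLex-minimal in $\{u\in\tilde X^*: (u\pi)\,\mathcal{D}\,(w\pi)\}$. *)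

(* Defs.v *)
From HB Require Import structures.
From mathcomp Require Import all_boot.
From mathcomp Require Import boolp classical_sets.
From Stdlib Require Import Relation_Operators.

Set Implicit Arguments.
Unset Strict Implicit.
Unset Printing Implicit Defensive.

Local Open Scope classical_set_scope.
Local Open Scope quotient_scope.

Section FreeInverseMonoid.
Variable X : finType.

(* The doubled alphabet: [inl x] is the letter x, [inr x] the letter x^-1. *)
Definition letter := (X + X)%type.

Definition word := seq letter.

Definition letter_inv (a : letter) : letter :=
  match a with inl x => inr x | inr x => inl x end.

Definition word_inv (u : word) : word := rev (map letter_inv u).

(* The Vagner congruence: the least congruence on words making
   u = u u^-1 u and (u u^-1)(v v^-1) = (v v^-1)(u u^-1). *)
Inductive vagner : word -> word -> Prop :=
| vagner_refl u : vagner u u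
| vagner_sym u v : vagner u v -> vagner v u
| vagner_trans u v w : vagner u v -> vagner v w -> vagner u w
| vagner_cat u u' v v' : vagner u u' -> vagner v v' ->
    vagner (u ++ v) (u' ++ v')
| vagner_reg u : vagner (u ++ word_inv u ++ u) u
| vagner_idemC u v :
    vagner ((u ++ word_inv u) ++ (v ++ word_inv v))
           ((v ++ word_inv v) ++ (u ++ word_inv u)).

Definition vagnerb : rel word := fun u v => `[< vagner u v >].

Lemma vagnerb_refl : reflexive vagnerb.
Proof. by move=> u; apply/asboolP; apply: vagner_refl. Qed.

Lemma vagnerb_sym : symmetric vagnerb.
Proof.
by move=> u v; apply/asboolP/asboolP; apply: vagner_sym.
Qed.

Lemma vagnerb_trans : transitive vagnerb.
Proof.
move=> v u w /asboolP uv /asboolP vw; apply/asboolP.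
exact: vagner_trans uv vw.
Qed.

Canonical vagner_equiv :=
  EquivRel vagnerb vagnerb_refl vagnerb_sym vagnerb_trans.

Definition FIM := {eq_quot vagner_equiv}.

HB.instance Definition _ := Choice.on FIM.
HB.instance Definition _ := EqQuotient.on FIM.

Definition fim_pi (u : word) : FIM := \pi_FIM u.

Lemma fim_piP u v : fim_pi u = fim_pi v <-> vagner u v.
Proof.
split; first by move=> /eqmodP /asboolP.
by move=> uv; apply/eqmodP/asboolP.
Qed.

Lemma fim_pi_repr (a : FIM) : fim_pi (repr a) = a.
Proof. exact: reprK. Qed.

Lemma letter_invK : involutive letter_inv.
Proof. by case. Qed.

Lemma word_invK : involutive word_inv.
Proof.
by move=> u; rewrite /word_inv map_rev revK -map_comp (eq_map letter_invK) map_id.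
Qed.

Lemma word_inv_cat u v : word_inv (u ++ v) = word_inv v ++ word_inv u.
Proof. by rewrite /word_inv map_cat rev_cat. Qed.

Lemma vagner_inv u v : vagner u v -> vagner (word_inv u) (word_inv v).
Proof.
elim=> {u v} [u|u v _|u v w _ uv _ vw|u u' v v' _ uu' _ vv'|u|u v].
- exact: vagner_refl.
- exact: vagner_sym.
- exact: vagner_trans uv vw.
- by rewrite !word_inv_cat; apply: vagner_cat.
- rewrite !word_inv_cat word_invK -catA.
  by rewrite -{2}(word_invK u); apply: vagner_reg.
- by rewrite !word_inv_cat !word_invK; apply: vagner_idemC.
Qed.

Definition fim_mul (a b : FIM) : FIM := fim_pi (repr a ++ repr b).
Definition fim_inv (a : FIM) : FIM := fim_pi (word_inv (repr a)).

Lemma fim_mul_pi u v : fim_mul (fim_pi u) (fim_pi v) = fim_pi (u ++ v).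
Proof. by apply/fim_piP/vagner_cat; apply/fim_piP; rewrite fim_pi_repr. Qed.

Lemma fim_inv_pi u : fim_inv (fim_pi u) = fim_pi (word_inv u).
Proof. by apply/fim_piP/vagner_inv; apply/fim_piP; rewrite fim_pi_repr. Qed.

Lemma fim_mulA : associative fim_mul.
Proof.
move=> a b c; rewrite -(fim_pi_repr a) -(fim_pi_repr b) -(fim_pi_repr c).
by rewrite !fim_mul_pi catA.
Qed.

Lemma fim_mul1 : left_id (fim_pi [::]) fim_mul.
Proof. by move=> a; rewrite -(fim_pi_repr a) fim_mul_pi. Qed.

Lemma fim_invK : involutive fim_inv.
Proof. by move=> a; rewrite -(fim_pi_repr a) !fim_inv_pi word_invK. Qed.

Lemma fim_invM : {morph fim_inv : a b / fim_mul a b >-> fim_mul b a}.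
Proof.
move=> a b; rewrite -(fim_pi_repr a) -(fim_pi_repr b).
by rewrite fim_mul_pi !fim_inv_pi fim_mul_pi word_inv_cat.
Qed.

HB.instance Definition _ :=
  isStarMonoid.Build FIM fim_mulA fim_mul1 fim_invK fim_invM.

Lemma fim_piM u v : fim_pi (u ++ v) = (fim_pi u * fim_pi v)%g.
Proof. by rewrite -fim_mul_pi. Qed.

Lemma fim_pi1 : fim_pi [::] = 1%g.
Proof. by []. Qed.

Lemma fim_piV u : fim_pi (word_inv u) = ((fim_pi u)^-1)%g.
Proof. by rewrite -fim_inv_pi. Qed.

Lemma fim_mulgVK (a : FIM) : (a * a^-1 * a)%g = a.
Proof.
rewrite -(fim_pi_repr a) -fim_piV -!fim_piM -catA.
exact/fim_piP/vagner_reg.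
Qed.

Lemma fim_idemC (a b : FIM) :
  ((a * a^-1) * (b * b^-1))%g = ((b * b^-1) * (a * a^-1))%g.
Proof.
rewrite -(fim_pi_repr a) -(fim_pi_repr b) -!fim_piV -!fim_piM.
exact/fim_piP/vagner_idemC.
Qed.

End FreeInverseMonoid.

Section Green.
Variable M : monoidType.
Local Open Scope group_scope.

(* Equality of the principal left (resp. right) ideals; since M has a unit,
   no unit has to be adjoined. *)
Definition green_L (a b : M) : Prop :=
  [set s * a | s in [set: M]] = [set s * b | s in [set: M]].

Definition green_R (a b : M) : Prop :=
  [set a * s | s in [set: M]] = [set b * s | s in [set: M]].

(* D as the composition of L and R. *)
Definition green_D (a b : M) : Prop := exists2 c, green_L a c & green_R c b.

Definition D_class (a : M) : set M := [set b | green_D b a].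

End Green.

Section ContextFree.
Variable A : finType.

(* Symbols are [inl B] for a nonterminal B and [inr a] for a terminal a;
   a rule (B, s) stands for B -> s, where s may be empty. *)
Record cfg := Cfg {
  nonterminal : finType;
  start : nonterminal;
  rules : seq (nonterminal * seq (nonterminal + A))
}.

Inductive cfg_step (G : cfg) :
    seq (nonterminal G + A) -> seq (nonterminal G + A) -> Prop :=
| CfgStep (B : nonterminal G) (s p q : seq (nonterminal G + A)) :
    (B, s) \in rules G -> cfg_step (p ++ inl B :: q) (p ++ s ++ q).

Definition cfg_derives (G : cfg) := clos_refl_trans _ (@cfg_step G).

Definition cfg_lang (G : cfg) : set (seq A) :=
  [set w | cfg_derives [:: inl (start G)] [seq inr a | a <- w]].

Definition context_free (L : set (seq A)) : Prop :=
  exists G : cfg, cfg_lang G = L.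

End ContextFree.

Section ShortLex.
Variables (T : eqType) (r : rel T).

Definition total_order : Prop :=
  [/\ reflexive r, antisymmetric r, transitive r & total r].

Fixpoint lex (u v : seq T) : bool :=
  match u, v with
  | [::], _ => true
  | _ :: _, [::] => false
  | a :: u', b :: v' => if a == b then lex u' v' else r a b
  end.

Definition shortlex (u v : seq T) : bool :=
  (size u < size v) || (size u == size v) && lex u v.

End ShortLex.

Definition is_min (T : Type) (le : rel T) (A : set T) (m : T) : Prop :=
  A m /\ forall x, A x -> le m x.

Definition D_equivalent (X : finType) (w : word X) : set (word X) :=
  [set u | green_D (fim_pi u) (fim_pi w)].

Definition DGeo (X : finType) : set (word X) :=
  [set w | is_min leq [set size u | u in D_equivalent w] (size w)].
Arguments DGeo : clear implicits.

Definition DSL (X : finType) (r : rel (letter X)) : set (word X) :=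
  [set w | is_min (shortlex r) (D_equivalent w) w].

(* Main.v *)
Require Import Defs.
From mathcomp Require Import all_boot zify.
From mathcomp Require Import boolp classical_sets.
From Stdlib Require Import Relation_Operators.

Set Implicit Arguments.
Unset Strict Implicit.
Unset Printing Implicit Defensive.

Local Open Scope classical_set_scope.

(** An element of the free inverse monoid is a finite subtree of the Cayley
graph of the free group (its Munn tree) with an initial and a terminal vertex,
and two elements are D-related exactly when their trees are translates of one
another.  A D-geodesic is thus a shortest walk through all the vertices of a
tree.

Take for the tree a tripod, written with A for the inverse of the letter a:
from a centre, one arm of length n runs along a, one of length n+1 along A, and
one of length n+1 is entered along b.  A walk through the three tips is
shortest only if it passes from tip to tip without detour and takes the tip of
the short arm in the middle, so the only D-geodesics for this tree are
b^(n+1) a^n A^(2n+1) and its inverse ([short_representatives]); hence one of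
the two lies in K.  Munn's theorem is not used for this: letting the letters
act as partial injections on a tripod drawn in a grid is enough
([walk_vagner], [walk_D]).

Conversely, in a D-geodesic b^m a^p A^q with q > 0 the branch walked to and fro
is no longer than the way in and the way out, that is p <= m and 2p <= q
([DGeo_blocks]): otherwise it can be exchanged with a shorter arm, which
preserves the D-class and shortens the word ([exchange_end_arm],
[exchange_start_arm]).

If K were context-free, the words of K in b*a*A* could be pumped inside b*a*A*
so that the number of a's grows while one of the two other exponents stays
fixed ([block_pumping]).  Pumping often enough violates p <= m or 2p <= q; the
inverse word is treated in the same way.

Pumping is needed both with a marked letter, in the manner of Ogden's lemma, and
without leaving b*a*A*.  The usual intersection with a regular language is
replaced by refining the pigeonhole principle: nonterminals are compared
together with the action of their yield on the states of an automaton
([marked_pumping]).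

The two particular languages satisfy the assumptions on K: every nonempty set of
words has a ShortLex-minimal element, and ShortLex-minimal words are shortest
([DSL_representative], [DSL_sub_DGeo]). *)

(** * Green's relations *)

Section GreenRelations.
Variable M : monoidType.
Implicit Types a b c : M.
Local Open Scope group_scope.

Lemma green_LP a b :
  green_L a b <-> (exists s, a = s * b) /\ (exists s, b = s * a).
Proof.
split=> [ab|[[s as_] [t bt]]].
  have [s _ sb] : [set s * b | s in [set: M]] a.
    by rewrite -ab; exists 1; rewrite ?mul1g.
  have [t _ ta] : [set s * a | s in [set: M]] b.
    by rewrite ab; exists 1; rewrite ?mul1g.
  by split; [exists s | exists t].
apply/seteqP; split=> _ [x _ <-].
- by exists (x * s) => //; rewrite -mulgA -as_.
- by exists (x * t) => //; rewrite -mulgA -bt.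
Qed.

Lemma green_RP a b :
  green_R a b <-> (exists s, a = b * s) /\ (exists s, b = a * s).
Proof.
split=> [ab|[[s as_] [t bt]]].
  have [s _ sb] : [set b * s | s in [set: M]] a.
    by rewrite -ab; exists 1; rewrite ?mulg1.
  have [t _ ta] : [set a * s | s in [set: M]] b.
    by rewrite ab; exists 1; rewrite ?mulg1.
  by split; [exists s | exists t].
apply/seteqP; split=> _ [x _ <-].
- by exists (s * x) => //; rewrite mulgA -as_.
- by exists (t * x) => //; rewrite mulgA -bt.
Qed.

(** The two relations commute, which makes their composition D symmetric and
transitive; the witness completes the egg-box square opposite to [c]. *)
Lemma green_RL_comm a b c :
  green_R a c -> green_L c b -> exists2 d, green_L a d & green_R d b.
Proof.
move=> /green_RP [[t act] [s cas]] /green_LP [[r' cb] [r bc]].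
exists (r * a).
  apply/green_LP; split; last by exists r.
  by exists r'; rewrite {2}act !mulgA -(mulgA _ r) -bc -cb.
apply/green_RP; split; first by exists t; rewrite {1}act bc mulgA.
by exists s; rewrite -mulgA -cas.
Qed.

Lemma green_D_refl a : green_D a a.
Proof. by exists a. Qed.

Lemma green_LD a b : green_L a b -> green_D a b.
Proof. by exists b. Qed.

Lemma green_RD a b : green_R a b -> green_D a b.
Proof. by exists a. Qed.

Lemma green_D_sym a b : green_D a b -> green_D b a.
Proof.
case=> c ac cb.
by have [d bd da] := green_RL_comm (esym cb) (esym ac); exists d.
Qed.

Lemma green_D_trans a b c : green_D a b -> green_D b c -> green_D a c.
Proof.
case=> d ad db [e be ec].
have [f df fe] := green_RL_comm db be.
by exists f; [apply: etrans ad df | apply: etrans fe ec].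
Qed.

(** The only consequence of D that the action on the grid uses. *)
Lemma green_D_factor a b : green_D a b -> exists s t, a = s * b * t.
Proof.
case=> c /green_LP [[s ->] _] /green_RP [[t ->] _].
by exists s, t; rewrite mulgA.
Qed.
End GreenRelations.

Section FIMExchange.
Variable X : finType.
Implicit Types x y z : FIM X.
Local Open Scope group_scope.

Lemma green_D_inv x y : green_D x y -> green_D x^-1 y^-1.
Proof.
case=> z /green_LP [[s xs] [t zt]] /green_RP [[s' zs] [t' yt]].
have [||d xd dy] := @green_RL_comm (FIM X) x^-1 y^-1 z^-1; last by exists d.
- by apply/green_RP; split; [exists s^-1; rewrite xs | exists t^-1; rewrite zt];
    rewrite invgM.
- by apply/green_LP; split; [exists s'^-1; rewrite zs | exists t'^-1; rewrite yt];
    rewrite invgM.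
Qed.

(** The word z y y^-1 x walks along z, makes a return trip along the branch y
and leaves along x.  Both walks below cover the same tree from the same start
and differ in which of the branches x, y is the return trip, so they are even
R-related.  The next lemma is the same exchange at the beginning. *)
Lemma exchange_end z y x : green_D (z * (y * y^-1) * x) (z * (x * x^-1) * y).
Proof.
suff H u v : z * (u * u^-1) * v * (v^-1 * u) = z * (v * v^-1) * u.
  by apply/green_RD/green_RP; split; [exists (y^-1 * x) | exists (x^-1 * y)];
    rewrite H.
have -> : z * (u * u^-1) * v * (v^-1 * u) = z * ((u * u^-1) * (v * v^-1)) * u.
  by rewrite !mulgA.
by rewrite fim_idemC -!mulgA [u * (u^-1 * u)]mulgA fim_mulgVK.
Qed.

Lemma exchange_start z y x : green_D (z * (y * y^-1) * x) (y^-1 * (z^-1 * z) * x).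
Proof.
suff H u v : v^-1 * u^-1 * (u * (v * v^-1) * x) = v^-1 * (u^-1 * u) * x.
  apply/green_LD/green_LP; split; [exists (z * y) | exists (y^-1 * z^-1)].
    by have := H y^-1 z^-1; rewrite !invgK.
  by rewrite H.
have -> : v^-1 * u^-1 * (u * (v * v^-1) * x)
        = v^-1 * ((u^-1 * u) * (v * v^-1)) * x by rewrite !mulgA.
have := fim_idemC u^-1 v; rewrite invgK => ->.
have := fim_mulgVK v^-1; rewrite invgK => E.
by rewrite !mulgA E.
Qed.
End FIMExchange.

(** * Pumping a context-free language along an automaton *)

Definition wpow (T : Type) (v : seq T) k := flatten (nseq k v).

Lemma wpowSr (T : Type) (v : seq T) k : wpow v k.+1 = wpow v k ++ v.
Proof.
elim: k => [|k IH]; first by rewrite /wpow /= cats0.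
by rewrite -[LHS]/(v ++ wpow v k.+1) [in LHS]IH catA.
Qed.

Section Derivations.
Variables (A : finType) (G : cfg A).
Implicit Types (s p q : seq (nonterminal G + A)) (w x u v : seq A).

(** The forests of derivation trees: the roots are labelled by the sentential
form and the leaves spell the word. *)
Inductive der : seq (nonterminal G + A) -> seq A -> Prop :=
| der_nil : der [::] [::]
| der_term a s w : der s w -> der (inr a :: s) (a :: w)
| der_nt B r s x w : (B, r) \in rules G -> der r x -> der s w ->
    der (inl B :: s) (x ++ w).

Lemma der_cat p q w x : der p w -> der q x -> der (p ++ q) (w ++ x).
Proof.
move=> pw qx; elim: pw => {p w} //= [a p w _|B r p y w Br ry _ _] IH.
  exact: der_term.
by rewrite -catA; apply: der_nt Br ry IH.
Qed.

Lemma der_catE p q w : der (p ++ q) w ->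
  exists w1 w2, [/\ w = w1 ++ w2, der p w1 & der q w2].
Proof.
elim: p w => [|c p IH] w /=.
  by move=> qw; exists [::], w; split=> //; apply: der_nil.
move E: (c :: p ++ q) => t H; case: H E => // [a s w' + [ec es]|B r s x w' Br rx + [ec es]].
  rewrite ec -es => /IH [w1 [w2 [-> pw1 qw2]]].
  by exists (a :: w1), w2; split=> //; apply: der_term.
rewrite ec -es => /IH [w1 [w2 [-> pw1 qw2]]].
exists (x ++ w1), w2; split=> //; first by rewrite catA.
exact: der_nt Br rx pw1.
Qed.

Lemma der_terminal w : der [seq inr a | a <- w] w.
Proof. by elim: w => [|a w]; [apply: der_nil | apply: der_term]. Qed.

Lemma der_one B r x : (B, r) \in rules G -> der r x -> der [:: inl B] x.
Proof. by move=> Br rx; rewrite -[x]cats0; apply: der_nt Br rx der_nil. Qed.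

Lemma der_derives s s' w : cfg_derives s s' -> der s' w -> der s w.
Proof.
move=> ss'; elim: ss' w => {s s'} [s s' [B r p q Br] w|//|s t s' _ IH1 _ IH2 w /IH2 /IH1 //].
move=> /der_catE [w1 [w2x [-> pw1 /der_catE [x [w2 [-> rx qw2]]]]]].
exact: der_cat pw1 (der_nt Br rx qw2).
Qed.

Lemma derives_ctx p q s s' :
  cfg_derives s s' -> cfg_derives (p ++ s ++ q) (p ++ s' ++ q).
Proof.
elim=> {s s'} [s s' [B r p' q' Br]|s|s t s' _ st _ ts'].
- have := CfgStep (p ++ p') (q' ++ q) Br.
  by rewrite -!catA => st; apply: rt_step; rewrite /= -?catA.
- exact: rt_refl.
- exact: rt_trans st ts'.
Qed.

Lemma derives_der s w : der s w -> cfg_derives s [seq inr a | a <- w].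
Proof.
elim=> {s w} [|a s w _ IH|B r s x w Br _ IHx _ IHw]; first exact: rt_refl.
  by have := derives_ctx [:: inr a] [::] IH; rewrite /= !cats0.
rewrite map_cat; apply: rt_trans (rt_step _ _ _ _ (CfgStep [::] s Br)) _.
apply: rt_trans (derives_ctx [::] s IHx) _ => /=.
by have := derives_ctx [seq inr a | a <- x] [::] IHw; rewrite !cats0.
Qed.

Lemma cfg_langP w : cfg_lang G w <-> der [:: inl (start G)] w.
Proof.
split=> [H|]; last exact: derives_der.
exact: der_derives H (der_terminal w).
Qed.

Variables (Q : finType) (delta : Q -> A -> Q) (mark : pred A).

(** The class of a word in the transition monoid of the automaton.  The
pigeonhole below compares nodes of a tree by their nonterminal and the effect
of their yield: if v x y and x have the same effect, then so do all the words
v^k x y^k, and pumping does not change the run of the automaton. *)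
Definition effect w : {ffun Q -> Q} := [ffun q => foldl delta q w].

(** [s] derives [w] with an inner node of label [st] above the factor of [w]
between [u] and [v].  Only the possibility of grafting another tree at this
node is recorded, so that no type of contexts is needed. *)
Definition occurs s w (st : nonterminal G * {ffun Q -> Q}) u v :=
  exists x, [/\ w = u ++ x ++ v, der [:: inl st.1] x, effect x = st.2
    & forall x', der [:: inl st.1] x' -> der s (u ++ x' ++ v)].

Definition pumpable s w :=
  exists u v x y z,
    [/\ w = u ++ v ++ x ++ y ++ z, has mark (v ++ y),
        effect (v ++ x ++ y) = effect x
      & forall k, der s (u ++ wpow v k ++ x ++ wpow y k ++ z)].

Lemma pumpable_cat p w s x q z :
  der p w -> der q z -> pumpable s x -> pumpable (p ++ s ++ q) (w ++ x ++ z).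
Proof.
move=> pw qz [u [v [x' [y [z' [-> vy Ex H]]]]]].
exists (w ++ u), v, x', y, (z' ++ z); split=> //; first by rewrite -!catA.
move=> k; have := der_cat pw (der_cat (H k) qz).
by rewrite -!catA.
Qed.

Lemma occurs_cat p w s x q z st u v :
  der p w -> der q z -> occurs s x st u v ->
  occurs (p ++ s ++ q) (w ++ x ++ z) st (w ++ u) (v ++ z).
Proof.
move=> pw qz [x' [-> dx ex H]]; exists x'; split=> //; first by rewrite -!catA.
move=> x'' /H H'; have := der_cat pw (der_cat H' qz).
by rewrite -!catA.
Qed.

Lemma occurs_rule B r x st u v :
  (B, r) \in rules G -> occurs r x st u v -> occurs [:: inl B] x st u v.
Proof.
move=> Br [x' [-> dx ex H]]; exists x'; split=> // x'' /H.
exact: der_one Br.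
Qed.

Lemma occurs_self B x : der [:: inl B] x ->
  occurs [:: inl B] x (B, effect x) [::] [::].
Proof. by move=> Bx; exists x; split=> [|//|//|x']; rewrite ?cats0. Qed.

(** A node with the label of the root can be replaced by a copy of the whole
tree, again and again. *)
Lemma occurs_pump B x u v :
  occurs [:: inl B] x (B, effect x) u v -> has mark (u ++ v) ->
  pumpable [:: inl B] x.
Proof.
move=> [x' [xE dx ex H]] huv; exists [::], u, x', v, [::].
split=> //; rewrite ?cats0 //; first by rewrite -xE.
move=> k; rewrite ?cats0 /=; elim: k => [|k IH]; first by rewrite /= cats0.
rewrite [wpow v _]wpowSr -[wpow u _]/(u ++ wpow u k).
by have := H _ IH; rewrite -!catA.
Qed.

(** The parameter [k] will bound the number of trees of the forest that have a
marked leaf.  Once there are two of them, every node has a marked leaf outside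
its own tree, which is what [occurs_pump] asks for. *)
Definition branching s w (S : {set nonterminal G * {ffun Q -> Q}}) k :=
  forall st, st \in S -> exists u v, occurs s w st u v /\ (2 <= k -> has mark (u ++ v)).

(** The counting step of Ogden's lemma, without following a path.  If no
pumping is possible and a node has at least two children with marked leaves,
then its label does not occur below it; so each such node uses up one label,
and multiplies the number of marks by at most [D].  A node with a single such
child changes nothing.  The set [S] collects the labels used along the worst
path, hence the maximum, instead of the union, where two trees are put side by
side. *)
Lemma marks_bound D s w : 0 < D -> (forall B r, (B, r) \in rules G -> size r <= D) ->
  der s w -> pumpable s w \/
  exists (S : {set nonterminal G * {ffun Q -> Q}}) k,
    [/\ k <= size s, count mark w <= k * D ^ #|S| & branching s w S k].
Proof.
move=> D0 ruleD; elim=> {s w} [|a s w sw IH|B r s x w Br rx IHx sw IHw].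
- by right; exists finset.set0, 0; split=> // st; rewrite inE.
- have da : der [:: inr a] [:: a] by apply/der_term/der_nil.
  case: IH => [P|[S [k [ks wS Sk]]]].
    by left; have := pumpable_cat da der_nil P; rewrite !cats0.
  right; exists S, (mark a + k); split.
  + by rewrite /=; case: (mark a) ks => /=; lia.
  + rewrite /= mulnDl leq_add // leq_pmulr // expn_gt0 D0 //.
  + move=> st /Sk [u [v [oc huv]]]; exists (a :: u), v; split.
      by have := occurs_cat da der_nil oc; rewrite !cats0.
    by rewrite /=; case: (mark a).
(* The tree with root [B] over the forest of [r]. *)
case: IHx => [P|[S1 [k1 [ks1 xS1 Sk1]]]].
  left; have [u [v [x' [y [z [-> h1 h2 h3]]]]]] := P.
  exists u, v, x', y, (z ++ w); split=> //; first by rewrite -!catA.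
  by move=> k; have := der_nt Br (h3 k) sw; rewrite -!catA.
have Bx := der_one Br rx.
have {xS1 Sk1} : pumpable [:: inl B] x \/ exists S : {set nonterminal G * {ffun Q -> Q}},
    count mark x <= D ^ #|S| /\ branching [:: inl B] x S 1.
  case: (leqP k1 1) => k11.
    right; exists S1; split.
      by apply: leq_trans xS1 _; rewrite -[leqRHS]mul1n leq_mul2r k11 orbT.
    by move=> st /Sk1 [u [v [/(occurs_rule Br) oc _]]]; exists u, v; split.
  have [Sin|Sout] := boolP ((B, effect x) \in S1).
    have [u [v [/(occurs_rule Br) oc /(_ k11) huv]]] := Sk1 _ Sin.
    by left; apply: occurs_pump oc huv.
  right; exists ((B, effect x) |: S1); split.
    rewrite cardsU1 Sout expnS; apply: leq_trans xS1 _.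
    by rewrite leq_mul2r (leq_trans ks1 (ruleD _ _ Br)) orbT.
  move=> st /setU1P [->|/Sk1 [u [v [/(occurs_rule Br) oc _]]]].
    by exists [::], [::]; split=> //; apply: occurs_self.
  by exists u, v.
(* The tree with root [B] next to the forest of [s]. *)
case=> [P|[S1' [xS1 Sk1]]].
  by left; apply: (pumpable_cat der_nil sw P).
case: IHw => [P|[S2 [k2 [ks2 wS2 Sk2]]]].
  by left; have := pumpable_cat Bx der_nil P; rewrite !cats0.
right.
have occ1 st : st \in S1' -> exists u v, occurs (inl B :: s) (x ++ w) st u (v ++ w).
  move=> /Sk1 [u [v [oc _]]]; exists u, v.
  exact: (occurs_cat der_nil sw oc).
have occ2 st : st \in S2 -> exists u v, occurs (inl B :: s) (x ++ w) st (x ++ u) v /\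
    (2 <= k2 -> has mark (u ++ v)).
  move=> /Sk2 [u [v [oc huv]]]; exists u, v; split=> //.
  by have := occurs_cat Bx der_nil oc; rewrite !cats0.
have [mx|mx] := posnP (count mark x).
  exists S2, k2; split; first exact: leqW.
    by rewrite count_cat mx.
  move=> st /occ2 [u [v [oc huv]]]; exists (x ++ u), v; split=> // /huv.
  by rewrite !has_cat => /orP [] ->; rewrite ?orbT.
have [mw|mw] := posnP (count mark w).
  exists S1', 1; split=> //; first by rewrite count_cat mw addn0 mul1n.
  by move=> st /occ1 [u [v oc]]; exists u, (v ++ w).
have b (S : {set nonterminal G * {ffun Q -> Q}}) : #|S1'| <= #|S| -> #|S2| <= #|S| ->
    count mark (x ++ w) <= k2.+1 * D ^ #|S|.
  move=> le1 le2; rewrite count_cat mulSn leq_add //.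
    by apply: leq_trans xS1 _; rewrite leq_pexp2l.
  by apply: leq_trans wS2 _; rewrite leq_mul2l leq_pexp2l ?orbT.
case: (leqP #|S1'| #|S2|) => cmp.
  exists S2, k2.+1; split=> //; first exact: b.
  move=> st /occ2 [u [v [oc _]]]; exists (x ++ u), v; split=> // _.
  by rewrite !has_cat (has_count _ x) mx.
exists S1', k2.+1; split=> //; first exact: b (ltnW cmp).
move=> st /occ1 [u [v oc]]; exists u, (v ++ w); split=> // _.
by rewrite !has_cat (has_count _ w) mw !orbT.
Qed.

End Derivations.

Lemma foldl_pump (A Q : finType) (delta : Q -> A -> Q) (v x y : seq A) k q :
  effect delta (v ++ x ++ y) = effect delta x ->
  foldl delta q (wpow v k ++ x ++ wpow y k) = foldl delta q x.
Proof.
move=> E; have {}E p : foldl delta p (v ++ x ++ y) = foldl delta p x.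
  by have /ffunP/(_ p) := E; rewrite !ffunE.
elim: k => [|k IH] in q *; first by rewrite /= cats0.
rewrite (wpowSr y) -[wpow v k.+1]/(v ++ wpow v k).
have -> : foldl delta q ((v ++ wpow v k) ++ x ++ wpow y k ++ y)
        = foldl delta (foldl delta (foldl delta q v) (wpow v k ++ x ++ wpow y k)) y.
  by rewrite !foldl_cat.
by rewrite IH -[RHS]E !foldl_cat.
Qed.

Lemma marked_pumping (A : finType) (L : set (seq A)) (mark : pred A)
    (Q : finType) (delta : Q -> A -> Q) :
  context_free L -> exists N, forall w, L w -> N < count mark w ->
  exists u v x y z, [/\ w = u ++ v ++ x ++ y ++ z, has mark (v ++ y) &
    forall k, let w' := u ++ wpow v k ++ x ++ wpow y k ++ z in
      L w' /\ forall q, foldl delta q w' = foldl delta q w].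
Proof.
case=> G <-.
pose D := (\max_(r <- rules G) size r.2).+1.
exists (D ^ #|{: nonterminal G * {ffun Q -> Q}}|) => w /cfg_langP Gw mw.
have ruleD B r : (B, r) \in rules G -> size r <= D.
  move=> Br; apply: leqW.
  exact: (@leq_bigmax_seq _ _ xpredT (fun r0 => size r0.2) _ Br).
have [] := marks_bound delta mark (ltn0Sn _) ruleD Gw.
  move=> [u [v [x [y [z [wE vy ef H]]]]]]; exists u, v, x, y, z; split=> // k w'.
  split=> [|q]; first by apply/cfg_langP; apply: H.
  have := foldl_pump k (foldl delta q u) ef.
  have /ffunP/(_ (foldl delta q u)) := ef; rewrite !ffunE => <-.
  by rewrite wE /w' !foldl_cat => ->.
move=> [S [k [k1 le _]]]; move: mw; rewrite ltnNge; case/negP.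
apply: leq_trans le _; rewrite -[leqRHS]mul1n.
by apply: leq_mul => //; rewrite leq_pexp2l // max_card.
Qed.

(** * Words in three blocks *)

Section Blocks.
Variables (A : finType) (ls : seq A).
Let m := size ls.

(** For [ls = [:: l1; ...; lm]], the automaton of the language l1* ... lm*:
its state is the index of the last letter read, and [ord_max] is the sink,
reached by a descent or by a letter outside [ls], for which [index] returns
[m]. *)
Definition rank (l : A) : 'I_m.+1 := inord (index l ls).
Definition block_step (q : 'I_m.+1) (l : A) : 'I_m.+1 :=
  if q <= rank l then rank l else ord_max.
Definition before : rel A := relpre (index^~ ls) leq.

Lemma rankE l : rank l = index l ls :> nat.
Proof. by rewrite inordK // ltnS index_size. Qed.

Lemma before_trans : transitive before.
Proof. by move=> y x z; apply: leq_trans. Qed.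

Lemma foldl_block_max w : foldl block_step (ord_max : 'I_m.+1) w = ord_max.
Proof.
elim: w => //= l w IH; rewrite [block_step _ l]/block_step; case: ifP => // le.
suff -> : rank l = ord_max by [].
 by apply/val_inj/anti_leq; rewrite le -ltnS ltn_ord.
Qed.

Lemma block_runP (q : 'I_m.+1) w : q != ord_max ->
  reflect (path leq q [seq index l ls | l <- w] /\ all [in ls] w)
          (foldl block_step q w != ord_max).
Proof.
elim: w q => [|l w IH] q qm /=; first by rewrite qm; constructor.
rewrite [block_step _ l]/block_step rankE; case: leqP => le /=; last first.
  by rewrite foldl_block_max eqxx; constructor=> -[].
have -> : (l \in ls) = (rank l != ord_max).
  by rewrite -index_mem -rankE -val_eqE /= -/m; have := ltn_ord (rank l); lia.
have [rm|rm] /= := eqVneq (rank l) ord_max.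
  by rewrite rm foldl_block_max eqxx; constructor=> -[].
by rewrite -(rankE l); apply: IH.
Qed.

End Blocks.

Definition blocks (A : Type) (l1 l2 l3 : A) x y z :=
  nseq x l1 ++ nseq y l2 ++ nseq z l3.

Lemma count_wpow (T : Type) (P : pred T) v k : count P (wpow v k) = k * count P v.
Proof. by elim: k => //= k IH; rewrite count_cat IH mulSn. Qed.

Section ThreeLetters.
Variables (A : finType) (l1 l2 l3 : A).
Let ls := [:: l1; l2; l3].
Hypothesis uls : uniq ls.

Lemma count_blocks x y z (w := blocks l1 l2 l3 x y z) :
  [/\ count_mem l1 w = x, count_mem l2 w = y & count_mem l3 w = z].
Proof.
move: uls; rewrite /= !inE !negb_or andbT => /andP [/andP [n12 n13] n23].
rewrite /w /blocks !count_cat !count_nseq /= !eqxx (negPf n12) (negPf n13) (negPf n23).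
by rewrite !(eq_sym l3) (eq_sym l2) (negPf n12) (negPf n13) (negPf n23) !mul1n !addn0.
Qed.

Lemma blocks_sorted x y z : sorted (before ls) (blocks l1 l2 l3 x y z).
Proof.
have nseq_sorted l k : pairwise (before ls) (nseq k l).
  by elim: k => //= k ->; rewrite andbT; apply/allP=> t /nseqP [-> _]; apply: leqnn.
rewrite sorted_pairwise; last exact: before_trans.
move: uls; rewrite /= !inE !negb_or andbT => /andP [/andP [n12 n13] n23].
rewrite !pairwise_cat !nseq_sorted !andbT; apply/andP; split;
  apply/allrelP=> s t /nseqP [-> _]; rewrite ?mem_cat.
  case/orP=> /nseqP [-> _]; by rewrite /before /= eqxx.
by move=> /nseqP [-> _]; rewrite /before /= !eqxx (negPf n12) (negPf n13) (negPf n23).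
Qed.

Lemma blocks_all x y z : all [in ls] (blocks l1 l2 l3 x y z).
Proof.
apply/allP=> t; rewrite !mem_cat !inE.
by case/or3P=> /nseqP [-> _]; rewrite eqxx ?orbT.
Qed.

Lemma sorted_blocks w : all [in ls] w -> sorted (before ls) w ->
  w = blocks l1 l2 l3 (count_mem l1 w) (count_mem l2 w) (count_mem l3 w).
Proof.
move=> wls sw; apply: (sorted_eq_in (leT := before ls)) => //.
- by move=> x y z _ _ _; apply: before_trans.
- move=> x y xw yw /anti_leq E.
  by rewrite -(nth_index x (allP wls _ xw)) E nth_index // (allP wls).
- exact: blocks_sorted.
- have [c1 c2 c3] := count_blocks (count_mem l1 w) (count_mem l2 w) (count_mem l3 w).
  apply/allP=> x; rewrite mem_cat => xin.
  have : x \in ls.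
    by case/orP: xin => [/(allP wls) //|/(allP (blocks_all _ _ _))].
  by rewrite !inE => /or3P [] /eqP ->; rewrite /= ?c1 ?c2 ?c3.
Qed.

(** The two pumped factors are repeated inside l1* l2* l3*, so each of them is
a power of one letter; one of them consists of the marked letter [l2], and
[l1] or [l3] is missing from both. *)
Lemma block_pumping (L : set (seq A)) : context_free L -> exists N, forall x y z,
  N < y -> L (blocks l1 l2 l3 x y z) ->
  exists i j h, [/\ 0 < j, (i == 0) || (h == 0)
    & forall k, L (blocks l1 l2 l3 (x + k * i) (y + k * j) (z + k * h))].
Proof.
case/(marked_pumping (pred1 l2) (block_step (ls := ls)))=> N HN.
exists N => x y z Ny Lxyz.
have [c1 c2 c3] := count_blocks x y z.
have [u [v [t [v' [u' [wE]]]]]] := HN _ Lxyz (eq_ind_r (leq N.+1) Ny c2).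
rewrite has_count => vv' Hk.
have wk k : let w' := u ++ wpow v k ++ t ++ wpow v' k ++ u' in
    [/\ L w', all [in ls] w' & sorted (before ls) w'].
  case: (Hk k) => Lw /(_ ord0); set w' := u ++ _ => E.
  have /block_runP [] // : foldl (block_step (ls := ls)) ord0 w' != ord_max.
    rewrite E; apply/block_runP=> //; split; last exact: blocks_all.
    rewrite path_min_sorted ?sorted_map; first exact: blocks_sorted.
    by apply/allP.
  by move=> /path_sorted; rewrite sorted_map.
exists (count_mem l1 (v ++ v')), (count_mem l2 (v ++ v')), (count_mem l3 (v ++ v')).
split=> //; last first.
  move=> k; have [Lw aw sw] := wk k.+1; move: Lw; rewrite (sorted_blocks aw sw).
  have cnt l : count_mem l (u ++ wpow v k.+1 ++ t ++ wpow v' k.+1 ++ u')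
      = count_mem l (blocks l1 l2 l3 x y z) + k * count_mem l (v ++ v').
    by rewrite wE !count_cat !count_wpow; lia.
  by rewrite !cnt c1 c2 c3.
(* When w w is sorted, any two letters of w are in order, whichever comes first
   in w. *)
have [_ _ sw] := wk 2.
have once w i j : subseq (w ++ w) (u ++ wpow v 2 ++ t ++ wpow v' 2 ++ u') ->
    i \in w -> j \in w -> index i ls <= index j ls.
  move=> ww iw jw; have := subseq_sorted (@before_trans _ ls) (subseq_trans _ ww) sw.
  move=> /(_ [:: i; j]); rewrite /= andbT; apply.
  by rewrite -cat1s cat_subseq ?sub1seq.
have {}once w : w = v \/ w = v' -> {in w &, forall i j, index i ls <= index j ls}.
  move=> ww i j; apply: once; rewrite /wpow /= !cats0.
  case: ww => ->; last first.
    do 3! apply: subseq_trans (suffix_subseq _ _).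
    by rewrite -catA catA; apply: prefix_subseq.
  apply: subseq_trans (suffix_subseq _ _).
  by rewrite -catA catA; apply: prefix_subseq.
have vP := once v (or_introl erefl); have vP' := once v' (or_intror erefl).
move: uls; rewrite /= !inE !negb_or andbT => /andP [/andP [n12 n13] n23].
have count0 l : (count_mem l (v ++ v') == 0) = (l \notin v ++ v').
  by apply/eqP/count_memPn.
move: vv'; rewrite -has_count has_pred1 !count0 -negb_and !mem_cat.
move=> in2; apply/negP=> /andP [in1 in3].
have lt12 : index l2 ls <= index l1 ls = false.
  by rewrite /= !eqxx (negPf n12).
have lt13 : index l3 ls <= index l1 ls = false.
  by rewrite /= !eqxx (negPf n13) .
have lt23 : index l3 ls <= index l2 ls = false.
  by rewrite /= !eqxx (negPf n12) (negPf n13) (negPf n23).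
case/orP: in1 => in1; case/orP: in2 => in2; case/orP: in3 => in3;
  by [rewrite vP in lt12 | rewrite vP' in lt12 | rewrite vP in lt13
     | rewrite vP' in lt13 | rewrite vP in lt23 | rewrite vP' in lt23].
Qed.
End ThreeLetters.

(** * The free inverse monoid acting on a grid *)

Lemma fim_D_factor (X : finType) (u v : word X) :
  green_D (fim_pi u) (fim_pi v) -> exists s t, vagner u (s ++ v ++ t).
Proof.
case/green_D_factor=> s [t uE]; exists (repr s), (repr t); apply/fim_piP.
by rewrite uE !fim_piM !fim_pi_repr mulgA.
Qed.

Lemma word_inv_nseq (X : finType) k (l : letter X) :
  word_inv (nseq k l) = nseq k (letter_inv l).
Proof. by rewrite /word_inv map_nseq rev_nseq. Qed.

Lemma word_inv_blocks (X : finType) (l1 l2 l3 : letter X) x y z :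
  word_inv (blocks l1 l2 l3 x y z) =
  blocks (letter_inv l3) (letter_inv l2) (letter_inv l1) z y x.
Proof. by rewrite !word_inv_cat !word_inv_nseq -catA. Qed.

(** The letters [a] and [b] are unit steps to the right and upwards, and the
other generators act nowhere.  Restricted to a set [P] of points they are
still partial injections, so every [P] carries an action of the free inverse
monoid. *)
Section GridWalks.
Variables (X : finType) (a b : X).
(** The test x != a keeps the steps deterministic even if [a = b]. *)
Definition edge (x : X) (p q : nat * nat) : bool :=
  (x == a) && (q == (p.1.+1, p.2)) || (x != a) && (x == b) && (q == (p.1, p.2.+1)).

Definition step (l : letter X) p q :=
  match l with inl x => edge x p q | inr x => edge x q p end.

Fixpoint walk (P : pred (nat * nat)) (w : word X) p q : Prop :=
  if w is l :: w' then exists r, [/\ P p, step l p r & walk P w' r q]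
  else P p /\ p = q.

Lemma step_inv l p q : step (letter_inv l) p q = step l q p.
Proof. by case: l. Qed.

Lemma stepP l p q : step l p q ->
  [\/ l = inl a /\ q = (p.1.+1, p.2), l = inl b /\ q = (p.1, p.2.+1),
      l = inr a /\ p = (q.1.+1, q.2) | l = inr b /\ p = (q.1, q.2.+1)].
Proof.
case: l => x /= /orP [/andP [/eqP-> /eqP->]|/andP [/andP [_ /eqP->] /eqP->]].
- exact: Or41.
- exact: Or42.
- exact: Or43.
- exact: Or44.
Qed.

Lemma step_det l p q q' : step l p q -> step l p q' -> q = q'.
Proof.
case: l => x /= /orP [/andP [/eqP-> /eqP E]|/andP [/andP [/negPf n /eqP E'] /eqP E]];
  rewrite /edge ?eqxx ?n ?E' ?eqxx /= ?orbF ?n => /eqP; move: E.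
- by move=> -> ->.
- by move=> -> ->.
- by case: q q' => [? ?] [? ?] -> /= [-> ->].
- by case: q q' => [? ?] [? ?] -> /= [-> ->].
Qed.

Variable P : pred (nat * nat).

Lemma walk_ends w p q : walk P w p q -> P p /\ P q.
Proof.
elim: w p => /= [p [Pp <-] //|l w IH p [r [Pp _ /IH [_ Pq]]]]; by split.
Qed.

Lemma walk_cat u v p q :
  walk P (u ++ v) p q <-> exists2 r, walk P u p r & walk P v r q.
Proof.
elim: u p => /= [|l u IH] p.
  split=> [pq|[r [_ <-] //]]; exists p => //.
  by have [] := walk_ends pq.
split=> [[r [Pp st /IH [s rs sq]]]|[s [r [Pp st rs] sq]]].
  by exists s => //; exists r.
by exists r; split=> //; apply/IH; exists s.
Qed.

Lemma walk_inv w p q : walk P (word_inv w) p q <-> walk P w q p.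
Proof.
suff H u s t : walk P u s t -> walk P (word_inv u) t s.
  by split=> /H //; rewrite word_invK.
elim: u s => /= [s [Ps <-] //|l u IH s [r [Ps st rt]]].
rewrite -cat1s word_inv_cat; apply/walk_cat; exists r; first exact: IH.
exists s; rewrite /= step_inv; split=> //.
by have [] := walk_ends rt.
Qed.

Lemma walk_det w p q q' : walk P w p q -> walk P w p q' -> q = q'.
Proof.
elim: w p => /= [p [_ <-] [_ <-] //|l w IH p [r [_ st rq]] [r' [_ st' rq']]].
by move: rq'; rewrite -(step_det st st'); apply: IH.
Qed.

Lemma walk_idem u p q : walk P (u ++ word_inv u) p q <-> p = q /\ exists r, walk P u p r.
Proof.
split=> [/walk_cat [r pr /walk_inv qr]|[<- [r pr]]]; last first.
  by apply/walk_cat; exists r => //; apply/walk_inv.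
split; last by exists r.
by apply: (@walk_det (word_inv u) r); apply/walk_inv.
Qed.

(** A word acts by a partial injection and [word_inv] by its inverse; the
defining relations of the free inverse monoid hold in every monoid of partial
injections. *)
Lemma walk_vagner u v : vagner u v -> forall p q, walk P u p q <-> walk P v p q.
Proof.
elim=> {u v} [u|u v _ IH|u v w _ IH1 _ IH2|u u' v v' _ IH1 _ IH2|u|u v] p q.
- by [].
- by rewrite IH.
- by rewrite IH1.
- by split=> /walk_cat [r /IH1 pr /IH2 rq]; apply/walk_cat; exists r.
- rewrite catA; split=> [/walk_cat [r /walk_idem [<- _] //]|pq].
  by apply/walk_cat; exists p => //; apply/walk_idem; split=> //; exists q.
- by split=> /walk_cat [_ /walk_idem [<- ?] /walk_idem [<- ?]];
    apply/walk_cat; exists p => //; apply/walk_idem; split.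
Qed.

(** As D-related words are factors of each other, they act somewhere on the
same sets [P]. *)
Lemma walk_D u v p q : green_D (fim_pi u) (fim_pi v) -> walk P u p q ->
  exists p' q', walk P v p' q'.
Proof.
case/fim_D_factor=> s [t uE] /(walk_vagner uE).
by move=> /walk_cat [p' _ /walk_cat [q' pq _]]; exists p', q'.
Qed.

Lemma walk_visit t w p q : walk P w p q ->
  walk (predD1 P t) w p q \/
  exists w1 w2, [/\ w = w1 ++ w2, walk P w1 p t & walk P w2 t q].
Proof.
elim: w p => [|l w IH] p.
  move=> [Pp <-]; have [<-|pt] := eqVneq p t; last by left; rewrite /= pt.
  by right; exists [::], [::].
move=> pq; have [<-|pt] := eqVneq p t.
  right; exists [::], (l :: w); split=> //.
  by have [] := walk_ends pq.
have [r [Pp st /IH rq]] := pq; case: rq => [rq|[w1 [w2 [-> rt tq]]]].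
  by left; exists r; rewrite /= pt.
by right; exists (l :: w1), w2; split=> //; exists r.
Qed.

Lemma walk_between u1 u2 v1 v2 p s t : u1 ++ u2 = v1 ++ v2 -> size u1 <= size v1 ->
  walk P u1 p s -> walk P v1 p t ->
  exists x, [/\ v1 = u1 ++ x, u2 = x ++ v2 & walk P x s t].
Proof.
move=> E le pu pv; have v1E : v1 = u1 ++ drop (size u1) v1.
  have := congr1 (take (size u1)) E; rewrite take_size_cat // takel_cat // => u1E.
  by rewrite {1}u1E cat_take_drop.
exists (drop (size u1) v1); split=> //.
  by apply/eqP; move/eqP: E; rewrite {1}v1E -catA eqseq_cat // eqxx.
move: pv; rewrite {1}v1E => /walk_cat [s' pu' st].
by rewrite (walk_det pu pu').
Qed.

Definition dist (p q : nat * nat) := (p.1 - q.1) + (q.1 - p.1) + ((p.2 - q.2) + (q.2 - p.2)).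

Lemma step_dist l p r q : step l p r -> dist p q <= (dist r q).+1.
Proof. by rewrite /dist => /stepP [] [_ ->] /=; lia. Qed.

Lemma walk_dist w p q : walk P w p q -> dist p q <= size w.
Proof.
elim: w p => [|l w IH] p; first by move=> [_ ->]; rewrite /dist; lia.
by move=> [r [_ /(step_dist q) st /IH rq]]; apply: leq_trans st _.
Qed.

Lemma walk_right k p : (forall i, i <= k -> P (p.1 + i, p.2)) ->
  walk P (nseq k (inl a)) p (p.1 + k, p.2).
Proof.
elim: k p => [|k IH] p Pp.
  by have := Pp 0 isT; rewrite /= addn0; case: p {Pp}.
exists (p.1.+1, p.2); split; first by have := Pp 0 isT; rewrite addn0; case: p {Pp}.
  by rewrite /= /edge !eqxx.
rewrite -[p.1 + k.+1]addSnnS; apply: (IH (p.1.+1, p.2)) => i ik.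
by rewrite /= addSnnS; apply: Pp.
Qed.

Lemma walk_up k p : b != a -> (forall i, i <= k -> P (p.1, p.2 + i)) ->
  walk P (nseq k (inl b)) p (p.1, p.2 + k).
Proof.
move=> ba; elim: k p => [|k IH] p Pp.
  by have := Pp 0 isT; rewrite /= addn0; case: p {Pp}.
exists (p.1, p.2.+1); split; first by have := Pp 0 isT; rewrite addn0; case: p {Pp}.
  by rewrite /= /edge !eqxx ba orbT.
rewrite -[p.2 + k.+1]addSnnS; apply: (IH (p.1, p.2.+1)) => i ik.
by rewrite /= addSnnS; apply: Pp.
Qed.

Lemma walk_rightE k p q : walk P (nseq k (inl a)) p q -> q = (p.1 + k, p.2).
Proof.
elim: k p => [|k IH] p /=; first by case: p => ? ? [_ <-]; rewrite addn0.
case=> r [_]; rewrite /edge eqxx /= orbF => /eqP -> /IH -> /=.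
by rewrite addSnnS.
Qed.

Lemma walk_upE k p q : b != a -> walk P (nseq k (inl b)) p q -> q = (p.1, p.2 + k).
Proof.
move=> ba; elim: k p => [|k IH] p /=; first by case: p => ? ? [_ <-]; rewrite addn0.
case=> r [_]; rewrite /edge eqxx (negPf ba) /= => /eqP -> /IH -> /=.
by rewrite addSnnS.
Qed.

(** A walk that is as short as the distance of its ends gains one unit at each
step. *)
Lemma short_walk_right k p w : walk P w p (p.1 + k, p.2) -> size w <= k ->
  w = nseq k (inl a).
Proof.
elim: k w p => [|k IH] [|l w] p //=; first by move=> [_]; case: p => ? ? [] /=; lia.
case=> r [_ st rq] wk; have := walk_dist rq; rewrite /dist.
case: (stepP st) => -[-> E]; rewrite E /= => d; rewrite ?E /=; try lia.
by congr cons; apply: (IH w (p.1.+1, p.2)) => //=; rewrite addSnnS -E.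
Qed.
End GridWalks.

(** * The tripod and its geodesics *)

Lemma size_word_inv (X : finType) (w : word X) : size (word_inv w) = size w.
Proof. by rewrite size_rev size_map. Qed.

Section TestWord.
Variables (X : finType) (a b : X).
Hypothesis ba : b != a.
Variable n : nat.
Let N := n.+1.

(** The tripod with centre (N, N), drawn in the grid as the letter T: the
crossbar holds the arms along the inverse of [a] and along [a], of lengths N
and n = N - 1, and the stem holds the arm entered along [b], of length N. *)
Definition tee : pred (nat * nat) :=
  [pred p | (p.2 == N) && (p.1 <= N + n) || (p.1 == N) && (p.2 <= N)].

Definition tee_word : word X := blocks (inl b) (inl a) (inr a) N n (N + n).

Notation tipB := (N, 0).
Notation tipA := (N + n, N).
Notation tipC := (0, N).

Lemma walk_tee_word : walk a b tee tee_word tipB tipC.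
Proof.
apply/walk_cat; exists (N, N).
  apply: (@walk_up _ a b tee N tipB ba) => i iN.
  by rewrite /tee inE /= eqxx iN orbT.
apply/walk_cat; exists tipA.
  apply: (@walk_right _ a b tee n (N, N)) => i iN.
  by rewrite /tee inE /= eqxx leq_add2l iN.
have -> : nseq (N + n) (inr a : letter X) = word_inv (nseq (N + n) (inl a)).
  by rewrite word_inv_nseq.
apply/walk_inv; apply: (@walk_right _ a b tee (N + n) tipC) => i iN.
by rewrite /tee inE /= eqxx iN.
Qed.

(** The first and the last block are as long as the longest segment of the
tripod in their direction, which leaves only one position for the word, and in
this position it visits the three tips. *)
Lemma walk_tee_wordE (P : pred (nat * nat)) p q : {subset P <= tee} ->
  walk a b P tee_word p q -> [&& P tipB, P tipA & P tipC].
Proof.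
move=> Ptee /walk_cat [r pr /walk_cat [s rs sq]].
have [Pp Pr] := walk_ends pr; have [Ps Pq] := walk_ends sq.
move: sq; rewrite -[nseq _ _]word_invK word_inv_nseq => /walk_inv /walk_rightE /= sE.
have rE := walk_upE ba pr; have sE' := walk_rightE rs.
have := Ptee _ Pp; have := Ptee _ Pr; have := Ptee _ Ps; have := Ptee _ Pq.
rewrite /tee !inE /= => Hq Hs Hr Hp.
rewrite {}rE /= in sE' Hr; rewrite {}sE' /= in sE Hs Ps.
have [pE qE] : p = tipB /\ q = tipC.
  move: p q sE Hp Hq Hr Hs {pr rs Pp Pq Ps Pr} => [p1 p2] [q1 q2] /= [e1 e2].
  by rewrite /N in e1 e2 * => *; split; congr pair; lia.
by move: Pp Pq Ps; rewrite {}pE {}qE /= => -> -> ->.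
Qed.

(** A walk of [w] without the tip [t] would be a walk in the tripod with [t]
deleted; by [walk_D] the test word would walk there too. *)
Lemma tip_unavoidable w p q t : green_D (fim_pi w) (fim_pi tee_word) ->
  t \in [:: tipB; tipA; tipC] -> ~ walk a b (predD1 tee t) w p q.
Proof.
move=> wD tin /(walk_D wD) [p' [q']].
have sub : {subset predD1 tee t <= tee} by move=> s; rewrite inE => /andP [].
move/(walk_tee_wordE sub); rewrite !inE in tin *.
by case/or3P: tin => /eqP ->; rewrite /= eqxx ?andbF.
Qed.

Lemma tip_visited w1 w2 p q r t :
  green_D (fim_pi (w1 ++ w2)) (fim_pi tee_word) -> t \in [:: tipB; tipA; tipC] ->
  walk a b tee w1 p q -> walk a b tee w2 q r ->
  (exists u v, [/\ w1 = u ++ v, walk a b tee u p t & walk a b tee v t q]) \/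
  (exists u v, [/\ w2 = u ++ v, walk a b tee u q t & walk a b tee v t r]).
Proof.
move=> wD tin /(walk_visit t) [pq|]; last by left.
move=> /(walk_visit t) [qr|]; last by right.
by case: (tip_unavoidable wD tin (p := p) (q := r)); apply/walk_cat; exists q.
Qed.

(** The vertex is strictly below the crossbar as long as j < N, where a step
to the right leaves the tripod; so the distance can only be decreased by [b].
*)
Lemma short_walk_BA w j : j <= N -> walk a b tee w (N, j) tipA ->
  size w <= N - j + n -> w = nseq (N - j) (inl b) ++ nseq n (inl a).
Proof.
move: {2}(N - j) (erefl (N - j)) => d; elim: d j w => [|d IH] j w dE jN.
  have -> : j = N by lia.
  by rewrite subnn /=; apply: (@short_walk_right _ a b tee n (N, N)).
case: w => [|l w].
  by case=> _ []; lia.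
move=> [[r1 r2] [_ st rq]] /= wk; have := walk_dist rq; rewrite /dist.
have [tr _] := walk_ends rq; move: tr; rewrite /tee inE.
case: (stepP st) => -[-> [E1 E2]]; rewrite /= in E1 E2 *; try (move=> *; exfalso; lia).
move=> tr d1; rewrite dE /=; congr cons.
have dE' : N - j.+1 = d by lia.
rewrite -dE'; apply: (IH j.+1) => //=; try lia.
by move: rq; rewrite E1 E2.
Qed.

Lemma short_walk_AC w : walk a b tee w tipA tipC -> size w <= N + n ->
  w = nseq (N + n) (inr a).
Proof.
rewrite -{1 3}(word_invK w) -[size w](size_word_inv w) => /walk_inv wk sz.
by rewrite (@short_walk_right _ a b tee (N + n) tipC _ wk sz) word_inv_nseq.
Qed.

Lemma tight_path w u1 u2 u3 u4 : size w <= size tee_word ->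
  w = u1 ++ u2 ++ u3 ++ u4 ->
  walk a b tee u2 tipB tipA -> walk a b tee u3 tipA tipC -> w = tee_word.
Proof.
move=> + wE w2 w3; have := walk_dist w2; have := walk_dist w3.
rewrite /tee_word /blocks wE !size_cat !size_nseq /dist /= => d3 d2 sz.
have /size0nil -> : size u1 = 0 by lia.
have /size0nil -> : size u4 = 0 by lia.
rewrite (@short_walk_BA u2 0 isT w2); last by lia.
by rewrite (short_walk_AC w3) ?cats0 -?catA //; lia.
Qed.

(** The distances between tips are d(A, B) = d(A, C) = N + n and d(B, C) = 2N,
and the test word has length 2(N + n).  Going through B and C one after the
other and on to A, or back, is longer than this; so A is visited between B and
C, and the two parts are shortest walks without anything before or after. *)
Lemma short_representatives w : green_D (fim_pi w) (fim_pi tee_word) ->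
  size w <= size tee_word -> w = tee_word \/ w = word_inv tee_word.
Proof.
move=> wD sz.
have [p [q pq]] := walk_D (green_D_sym wD) walk_tee_word.
have [tB tA tC] : [/\ tipB \in [:: tipB; tipA; tipC], tipA \in [:: tipB; tipA; tipC]
    & tipC \in [:: tipB; tipA; tipC]] by rewrite !inE !eqxx !orbT.
have [] := walk_visit tipA pq; first by move/(tip_unavoidable wD tA).
move=> [w1 [w2 [wE pA Aq]]]; rewrite wE in wD.
(* Here [x] is the part between B and C, and [v] the part to or from A. *)
have far s t (u x v : word X) :
    (s, t) = (tipB, tipC) \/ (s, t) = (tipC, tipB) ->
    walk a b tee x s t -> walk a b tee v t tipA \/ walk a b tee v tipA s ->
    size w = size u + size x + size v -> False.
  move=> st /walk_dist dx dv wE'; move: sz; apply/negP; rewrite -ltnNge wE'.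
  rewrite /tee_word /blocks !size_cat !size_nseq.
  by case: dv dx => /walk_dist; case: st => -[-> ->]; rewrite /dist /=; lia.
have := tip_visited wD tC pA Aq; have := tip_visited wD tB pA Aq.
case=> [[u1 [u2 [w1E pB BA]]]|[u1 [u2 [w2E AB Bq]]]]
       [[v1 [v2 [w1E' pC CA]]]|[v1 [v2 [w2E' AC Cq]]]].
- have E : u1 ++ u2 = v1 ++ v2 by rewrite -w1E.
  case: (leqP (size u1) (size v1)) => le.
    have [x [v1E u2E BC]] := walk_between E le pB pC.
    case: (@far tipB tipC (u1 ++ w2) x v2); [by left | by [] | by left|].
    by rewrite wE w1E' v1E !size_cat; lia.
  have [x [u1E v2E CB]] := walk_between (esym E) (ltnW le) pC pB.
  case: (@far tipC tipB (v1 ++ w2) x u2); [by right | by [] | by left|].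
  by rewrite wE w1E u1E !size_cat; lia.
- by left; apply: (tight_path sz _ BA AC); rewrite wE w1E w2E' -catA.
- right; apply: (can_inj (@word_invK X)); rewrite word_invK.
  apply: (@tight_path _ (word_inv u2) (word_inv u1) (word_inv v2) (word_inv v1)).
  + by rewrite size_word_inv.
  + by rewrite wE w2E w1E' !word_inv_cat -!catA.
  + exact/walk_inv.
  + exact/walk_inv.
- have E : u1 ++ u2 = v1 ++ v2 by rewrite -w2E.
  case: (leqP (size u1) (size v1)) => le.
    have [x [v1E u2E BC]] := walk_between E le AB AC.
    case: (@far tipB tipC (w1 ++ v2) x u1); [by left | by [] | by right|].
    by rewrite wE w2E' v1E !size_cat; lia.
  have [x [u1E v2E CB]] := walk_between (esym E) (ltnW le) AC AB.
  case: (@far tipC tipB (w1 ++ u2) x v1); [by right | by [] | by right|].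
  by rewrite wE w2E u1E !size_cat; lia.
Qed.
End TestWord.

(** * Exchanging arms in a geodesic *)

Section WordExchange.
Variable X : finType.
Implicit Types (x y z w u : word X).
Local Open Scope group_scope.

Lemma exchange_end_arm z y x :
  green_D (fim_pi (z ++ y ++ word_inv y ++ x)) (fim_pi (z ++ x ++ word_inv x ++ y)).
Proof.
have := exchange_end (fim_pi z) (fim_pi y) (fim_pi x).
by rewrite !fim_piM !fim_piV !mulgA.
Qed.

Lemma exchange_start_arm z y x :
  green_D (fim_pi (z ++ y ++ word_inv y ++ x))
          (fim_pi (word_inv y ++ word_inv z ++ z ++ x)).
Proof.
have := exchange_start (fim_pi z) (fim_pi y) (fim_pi x).
by rewrite !fim_piM !fim_piV !mulgA.
Qed.

Lemma DGeo_le w : DGeo X w ->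
  forall u, green_D (fim_pi u) (fim_pi w) -> size w <= size u.
Proof. by move=> [_ H] u uw; apply: H; exists u. Qed.

Lemma DGeo_inv w : DGeo X w -> DGeo X (word_inv w).
Proof.
move=> wgeo; split; first by exists (word_inv w) => //; apply: green_D_refl.
move=> _ [u uw <-]; rewrite size_word_inv -(size_word_inv u).
apply: DGeo_le => //; rewrite fim_piV -[w in X in green_D _ X]word_invK fim_piV.
exact: green_D_inv.
Qed.

(** In lb^m la^p la^-q the side branch has length min(p, q) and the way out
from its foot has length max(q - p, 0).  When the side branch is longer than
the way out or than the way in, turning it into an end of the walk saves
steps. *)
Lemma DGeo_blocks lb la m p q :
  DGeo X (blocks lb la (letter_inv la) m p q) -> 0 < q -> p <= m /\ p.*2 <= q.
Proof.
move=> /DGeo_le geo q0.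
(* Any word D-related to the given one, split around its return trip, is at
   least as long. *)
have side k d u : k <= p -> k + d = q ->
    green_D (fim_pi ((nseq m lb ++ nseq (p - k) la) ++ nseq k la ++
       word_inv (nseq k la) ++ nseq d (letter_inv la))) (fim_pi u) -> m + p + q <= size u.
  move=> kp qE wu; have : green_D (fim_pi u) (fim_pi (blocks lb la (letter_inv la) m p q)).
    apply: green_D_sym; move: wu; rewrite word_inv_nseq -nseqD qE -!catA.
    by rewrite (catA (nseq (p - k) la)) -nseqD subnK.
  by move/geo; rewrite !size_cat !size_nseq addnA.
have [qp|pq] := leqP q p.
  have := side q 0 _ qp (addn0 q) (exchange_end_arm _ _ _).
  by rewrite !size_cat !size_nseq /=; lia.
have pE : p + (q - p) = q by lia.
have := side p (q - p) _ (leqnn p) pE (exchange_start_arm _ _ _).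
have := side p (q - p) _ (leqnn p) pE (exchange_end_arm _ _ _).
by rewrite !size_cat !size_word_inv !size_cat !size_nseq; lia.
Qed.
End WordExchange.

(** * ShortLex representatives *)

Section Minimum.
Variables (T : finType) (r : rel T).
Hypothesis r_order : total_order r.

Lemma total_order_min (H : set T) : H !=set0 -> exists2 h, H h & forall x, H x -> r h x.
Proof.
case: r_order => rr _ rt rtot [x0 Hx0].
pose s := sort r [seq x <- enum T | `[< H x >]].
have sE x : x \in s = `[< H x >] by rewrite mem_sort mem_filter mem_enum andbT.
have : sorted r s by apply: sort_sorted.
case: s sE => [|h s] sE hs; first by move: (sE x0); rewrite asboolT.
exists h; first by apply/asboolP; rewrite -sE mem_head.
move=> x /asboolP; rewrite -sE inE => /predU1P [->|xs]; first exact: rr.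
exact: (allP (order_path_min rt hs)).
Qed.

(** Among words of one length the letters are minimised one after the other;
without the bound on the length the lexicographic order need not be well-
founded. *)
Lemma lex_min n (W : set (seq T)) : W !=set0 -> (forall w, W w -> size w = n) ->
  exists2 w, W w & forall u, W u -> lex r w u.
Proof.
elim: n W => [|n IH] W [w0 Ww0] sW.
  by exists w0 => // u _; rewrite (size0nil (sW _ Ww0)).
have [|h [t Wht] hmin] := @total_order_min [set h | exists t, W (h :: t)].
  by case: w0 Ww0 (sW _ Ww0) => // h t Wht _; exists h, t.
have [||t0 Wt0 tmin] := IH [set t | W (h :: t)].
- by exists t.
- by move=> u /sW [].
exists (h :: t0) => // -[|x u] Wu; first by have := sW _ Wu.
rewrite /=; case: eqVneq => [e|_]; last by apply: hmin; exists u.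
by apply: tmin; rewrite /= e.
Qed.

Lemma shortlex_min (W : set (seq T)) : W !=set0 -> exists w, is_min (shortlex r) W w.
Proof.
case=> w0 Ww0; pose has_size n := `[< exists2 w, W w & size w = n >].
have ex : exists n, has_size n by exists (size w0); apply/asboolP; exists w0.
case: (ex_minnP ex) => n /asboolP [w1 Ww1 s1] nmin.
have [||w [Ww sw] wmin] := @lex_min n [set w | W w /\ size w = n].
- by exists w1.
- by move=> w [].
exists w; split=> // u Wu; rewrite /shortlex sw.
have : n <= size u by apply/nmin/asboolP; exists u.
by rewrite leq_eqVlt => /predU1P [e|->//]; rewrite e eqxx wmin ?orbT.
Qed.
End Minimum.

Lemma DSL_sub_DGeo (X : finType) (r : rel (letter X)) : DSL r `<=` DGeo X.
Proof.
move=> w [Dw wmin]; split; first by exists w.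
by move=> _ [u /wmin + <-] => /orP [/ltnW|/andP [/eqP -> _]].
Qed.

Lemma DSL_representative (X : finType) (r : rel (letter X)) (c : FIM X) :
  total_order r -> exists2 w, DSL r w & D_class c (fim_pi w).
Proof.
move=> r_order; have [|w [wc wmin]] := @shortlex_min _ _ r_order (D_equivalent (repr c)).
  by exists (repr c); apply: green_D_refl.
exists w; last by have := wc; rewrite /D_equivalent /= fim_pi_repr.
split; first exact: green_D_refl.
by move=> u uw; apply: wmin; apply: green_D_trans uw wc.
Qed.

(** * Geodesic representatives are not context-free *)

Lemma geodesic_transversal_not_context_free (X : finType) (K : set (word X)) :
  2 <= #|X| -> K `<=` DGeo X ->
  (forall c : FIM X, exists2 w : word X, K w & D_class c (fim_pi w)) ->
  ~ context_free K.
Proof.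
move=> /card_gt1P [a [b [_ _ ab]]] Kgeo Krep Kcf.
have ba : b != a by rewrite eq_sym.
have nl : inl b != inl a :> letter X by apply: contraNneq ba => -[->].
have nr : inr a != inr b :> letter X by apply: contraNneq ab => -[->].
have [|N1 pump1] := @block_pumping _ (inl b) (inl a) (inr a) _ K Kcf.
  by rewrite /= !inE (negPf nl).
have [|N2 pump2] := @block_pumping _ (inl a) (inr a) (inr b) _ K Kcf.
  by rewrite /= !inE (negPf nr).
pose n := (maxn N1 N2).+1.
have [w Kw wD] := Krep (fim_pi (tee_word a b n)).
have wle := DGeo_le (Kgeo _ Kw) (green_D_sym wD).
(* The exponents of the test word satisfy the bounds of [DGeo_blocks] with a
   margin of one only, so two extra copies of the pumped factors break them. *)
case: (short_representatives ba wD wle) => wE; rewrite {}wE in Kw.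
  have [|i [j [h [j0 ih H]]]] := pump1 _ n _ _ Kw; first by rewrite /n; lia.
  have [|le1 le2] := DGeo_blocks (Kgeo _ (H 2)); first by lia.
  by case/orP: ih => /eqP ?; lia.
rewrite word_inv_blocks in Kw.
have [|i [j [h [j0 ih H]]]] := pump2 _ n _ _ Kw; first by rewrite /n; lia.
have := DGeo_inv (Kgeo _ (H 2)); rewrite word_inv_blocks /=.
move/(@DGeo_blocks _ (inl b) (inl a))=> [|le1 le2]; first by lia.
by case/orP: ih => /eqP ?; lia.
Qed.

Theorem theorem7p1 (X : finType) (hX : 2 <= #|X|) :
  (forall K : set (word X),
      K `<=` DGeo X ->
      (forall c : FIM X, exists2 w : word X, K w & D_class c (fim_pi w)) ->
      ~ context_free K)
  /\
  (forall r : rel (letter X),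
      total_order r ->
      ~ context_free (DGeo X) /\ ~ context_free (DSL r)).
Proof.
split=> [K|r r_order]; first exact: geodesic_transversal_not_context_free.
have repr c := @DSL_representative X r c r_order.
split; apply: geodesic_transversal_not_context_free => //; last exact: DSL_sub_DGeo.
by move=> c; have [w /DSL_sub_DGeo wgeo wc] := repr c; exists w.
Qed.
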